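(* Suppose that $G$ is a $\mathfrak{B}$-group, i.e. a finite group such that $\Phi(G/N)=1$ for every normal subgroup $N$ of $G$. Then $G$ is an $\mathbf{nC}$-group if and only if $G$ splits over each member of its generalised Fitting series.
   Context: All groups are finite; $\Phi(G)$ is the Frattini subgroup of $G$. A group $G$ splits over a normal subgroup $N$ if $N$ has a complement in $G$, i.e. there is $H\leq G$ with $G=NH$ and $N\cap H=1$. An $\mathbf{nC}$-group is a group in which every normal subgroup is complemented. The generalised Fitting subgroup is $F^{*}(G)=E(G)F(G)$, where $F(G)$ is the Fitting subgroup and $E(G)$ (the layer) is the product of all components of $G$, a component being a subnormal quasi-simple subgroup $Q$ (i.e. $Q$ is perfect and $Q/Z(Q)$ is simple). The generalised Fitting series of $G$ is defined inductively by $F_0^{*}(G)=1$ and $F_{i+1}^{*}(G)/F_i^{*}(G)=F^{*}(G/F_i^{*}(G))$ for $i\geq 0$. *)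

(* Defs.v *)
From mathcomp Require Import all_boot all_fingroup all_solvable.

Set Implicit Arguments.
Unset Strict Implicit.
Unset Printing Implicit Defensive.

Local Open Scope group_scope.

Section Defs.

Variable gT : finGroupType.
Implicit Types (A : {set gT}) (G Q : {group gT}).

Definition Bgroup A : Prop :=
  forall N : {group gT}, N <| A -> 'Phi(A / N) = 1.

Definition nCgroup A : Prop :=
  forall N : {group gT}, N <| A -> [splits A, over N].

Definition perfect A : bool := [~: A, A] == A.

(* MathComp's simple groups are nontrivial, so 1 is not quasisimple. *)
Definition quasisimple A : bool := perfect A && simple (A / 'Z(A)).

Definition component A Q : bool := (Q <|<| A) && quasisimple Q.

(* The product is taken in the join monoid of subgroups, hence does not depend *)
(* on an ordering of the components.                                           *)
Definition layer A : {set gT} :=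
  (\prod_(Q : {group gT} | component A Q) Q)%G.

Definition gen_Fitting A : {set gT} := layer A * 'F(A).

End Defs.

(* The i-th term of the series is the full preimage in A of F*(A / F*_(i-1)):  *)
(* same encoding as upper_central_at.                                          *)
Definition gen_Fitting_at i (gT : finGroupType) (A : {set gT}) : {set gT} :=
  iter i (fun B => coset B @*^-1 gen_Fitting (A / B)) 1.

(* Main.v *)
Require Import Defs.
From mathcomp Require Import all_boot all_fingroup all_solvable.

(** In a group G with trivial Frattini subgroup, F*(G) is completely reducible  *)
(** under G: F(G) is abelian and G-complemented, while the normal closure of a  *)
(** component Q is minimal normal, because a normal subgroup M not containing Q *)
(** centralises Q.  As F*(G) <> 1 when G <> 1, the series F_i reaches G, and    *)
(** one shows by downward induction on i that G splits over every normal N      *)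
(** containing F_i.  With R = F_(i+1), choose S normal in G so that S / F_i     *)
(** complements (N :&: R) / F_i in R / F_i; then complements of F_i, of R and   *)
(** of N R, the latter given by induction, combine with S into one of N.        *)

Set Implicit Arguments.
Unset Strict Implicit.
Unset Printing Implicit Defensive.

Local Open Scope group_scope.

(** The forward direction only needs each term F_i to be normal in G ([gen_Fitting_at_normal]). For
    the converse, the Frattini hypothesis is used on each G / F_i: there [gen_Fitting_compl] gives
    normal complements inside the generalised Fitting subgroup, just as in a semisimple module, and
    [gen_Fitting_neq1] makes the series grow strictly until it reaches G. [splits_relative_factor]
    then trades splitting over N for splitting over the larger N R, and the induction of
    [nCgroup_of_splits] ends at F_0 = 1, which lies in every N. *)

(** * Components, and how normal subgroups meet them *)

Section Quasisimple.

Variable gT : finGroupType.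
Implicit Types G M N Q T : {group gT}.

(** If T maps onto Q / Z(Q), then Q = Z(Q) T, so Q / T is abelian and perfectness forces T = Q. *)
Lemma quasisimpleP {Q} :
  reflect [/\ [~: Q, Q] = Q, Q :!=: 1
            & forall T, T <| Q -> T \subset 'Z(Q) \/ T :=: Q]
          (quasisimple Q).
Proof.
have nsZ : 'Z(Q) <| Q := center_normal Q.
apply: (iffP andP) => [[/eqP pQ /simpleP[ntQZ simQZ]] | [pQ ntQ nQ]].
  split=> // [|T nsTQ].
    apply: contraNneq ntQZ => Q1.
    by rewrite -subG1 quotient_sub1 ?normal_norm // {1}Q1 sub1G.
  have [QT1 | QTQ] := simQZ [group of T / 'Z(Q)] (quotient_normal _ nsTQ).
    left; rewrite -quotient_sub1 ?QT1 //.
    by rewrite (subset_trans (normal_sub nsTQ)) ?normal_norm.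
  right; apply/eqP; rewrite eqEsubset normal_sub //= -{1}pQ.
  apply: der1_min; first exact: normal_norm.
  have defQ: Q :=: 'Z(Q) * T.
    rewrite -quotientK ?(subset_trans (normal_sub nsTQ)) ?normal_norm //.
    by rewrite QTQ quotientGK.
  rewrite defQ quotientMidr quotient_abelian //; exact: center_abelian.
split; first by apply/eqP.
apply/simpleP; split.
  apply: contra_neq ntQ => QZ1; apply/eqP; rewrite -subG1 -pQ.
  have : Q \subset 'Z(Q) by rewrite -quotient_sub1 ?QZ1 // normal_norm.
  by rewrite subsetI subxx => /commG1P ->.
move=> H nsHQ.
have nsTQ : coset 'Z(Q) @*^-1 H <| Q.
  by rewrite -[X in _ <| X](quotientGK nsZ) cosetpre_normal.
have defH: H :=: (coset 'Z(Q) @*^-1 H) / 'Z(Q) by rewrite cosetpreK.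
have [sTZ | TQ] := nQ _ nsTQ; [left | right]; rewrite defH.
  by apply/trivgP; rewrite quotient_sub1 // (subset_trans sTZ) ?normG.
by rewrite TQ.
Qed.

Lemma quasisimpleJ Q (x : gT) : quasisimple Q -> quasisimple (Q :^ x).
Proof.
case/quasisimpleP=> pQ ntQ nQ; apply/(@quasisimpleP (Q :^ x)%G); split=> /=.
- by rewrite -conjsRg pQ.
- by rewrite -subG1 sub_conjg conjs1g subG1.
move=> T; rewrite -(conjsgKV x T) normalJ /center centJ -conjIg conjSg.
case/nQ=> [sTZ | ->]; first by left.
by right.
Qed.

Lemma componentJ G Q (x : gT) :
  x \in G -> component G Q -> component G (Q :^ x)%G.
Proof.
move=> Gx /andP[snQ qsQ]; rewrite /component quasisimpleJ // andbT.
have := morphim_subnormal (conjgm_morphism G x) snQ.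
by rewrite !morphim_conj setIid (setIidPr (subnormal_sub snQ)) (conjGid Gx).
Qed.

Lemma layer_normal G : layer G <| G.
Proof.
rewrite /layer bigprodGE /normal gen_subG; apply/andP; split.
  by apply/bigcupsP=> Q /andP[/subnormal_sub].
apply: norms_gen; apply/normsP=> x Gx.
apply/eqP; rewrite eqEcard cardJg leqnn andbT.
apply/subsetP=> _ /imsetP[y /bigcupP[Q cQ Qy] ->].
apply/bigcupP; exists (Q :^ x)%G; first exact: componentJ.
by rewrite memJ_conjg.
Qed.

Lemma gen_Fitting_group_set G : group_set (gen_Fitting G).
Proof.
apply/comm_group_setP/normC.
by rewrite (subset_trans (normal_sub (layer_normal G))) // normal_norm ?Fitting_normal.
Qed.

Canonical gen_Fitting_group G := group (gen_Fitting_group_set G).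

Lemma gen_Fitting_normal G : gen_Fitting G <| G.
Proof. by rewrite normalM ?layer_normal ?Fitting_normal. Qed.

Lemma component_sub_gen_Fitting G Q : component G Q -> Q \subset gen_Fitting G.
Proof.
move=> cQ; apply: subset_trans (mulG_subl 'F(G)%G (layer G)).
by rewrite /layer bigprodGE sub_gen // (bigcup_max Q).
Qed.

(* Induction on the subnormal defect: if Q is subnormal in K, a normal subgroup *)
(* of G, then [M, Q] lies in M :&: K, which Q centralises by induction.         *)
Lemma subnormal_perfect_cent G M Q :
    Q <|<| G -> M <| G -> [~: Q, Q] = Q -> Q \subset 'C(M :&: Q) ->
  Q \subset 'C(M).
Proof.
move=> snQ nsMG pQ cMQ; have [n] := ubnP #|G|.
elim: n => // n IHn in G M snQ nsMG cMQ *; rewrite ltnS => leGn.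
have [defG | [K [snQK nsKG prKG]]] := subnormalEr snQ.
  by rewrite -(setIidPl (normal_sub nsMG)) -defG.
have cMKQ : Q \subset 'C(M :&: K).
  apply: (IHn K (M :&: K)%G) => //=.
  - by rewrite (normalS _ (normal_sub nsKG)) ?subsetIr // normalI.
  - by rewrite (subset_trans cMQ) // centS // setSI // subsetIl.
  by rewrite (leq_trans (proper_card prKG)).
have sMQ : [~: M, Q] \subset M :&: K.
  rewrite subsetI commg_subl.
  rewrite (subset_trans (subnormal_sub snQ)) ?normal_norm //=.
  apply: subset_trans (commgS _ (subnormal_sub snQK)) _.
  by rewrite commg_subr (subset_trans (normal_sub nsMG)) ?normal_norm.
have MQQ : [~: M, Q, Q] = 1.
  by apply/commG1P; rewrite centsC (subset_trans cMKQ) ?centS.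
(* As Q is perfect, the three subgroups lemma turns [M, Q, Q] = 1 into [Q, M] = 1. *)
rewrite centsC; apply/commG1P; rewrite commGC -{1}pQ.
apply: three_subgroup => //; by rewrite [[~: Q, M]]commGC.
Qed.

Lemma component_sub_or_cent G M Q :
  component G Q -> M <| G -> Q \subset M \/ Q \subset 'C(M).
Proof.
case/andP=> snQ /quasisimpleP[pQ _ nQ] nsMG.
have nsMQ : M :&: Q <| Q.
  by rewrite setIC norm_normalI // (subset_trans (subnormal_sub snQ)) ?normal_norm.
have [sMZ | MQ] := nQ _ nsMQ; last by left; rewrite -MQ subsetIl.
right; apply: subnormal_perfect_cent snQ nsMG pQ _.
by rewrite centsC (subset_trans sMZ) ?subsetIr.
Qed.

End Quasisimple.

(** * Complete reducibility of the generalised Fitting subgroup when the Frattini subgroup is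
    trivial *)

Section FrattiniFree.

Variable gT : finGroupType.
Implicit Types A D G H K M N Q S T : {group gT}.

Lemma normal_not_sub_Phi G D :
    D <| G -> ~~ (D \subset 'Phi(G)) ->
  exists2 M : {group gT}, D * M = G & ~~ (D \subset M).
Proof.
move=> nsDG nDPhi; have [M /andP[maxM nDM]|noM] :=
  pickP [pred M : {group gT} | maximal M G && ~~ (D \subset M)].
  exists M => //; have [prMG maxMP] := maxgroupP maxM.
  have sDMG : D * M \subset G by rewrite mul_subG ?(proper_sub prMG) ?normal_sub.
  have nDMn : M \subset 'N(D).
    by rewrite (subset_trans (proper_sub prMG)) ?normal_norm.
  apply/eqP; rewrite eqEproper sDMG -norm_joinEr //.
  by apply: contra nDM => /maxMP <-; rewrite ?joing_subl ?joing_subr.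
case/negP: nDPhi; apply/bigcapsP=> M /predU1P[-> | maxM]; first exact: normal_sub.
have := noM M; rewrite /= maxM /=; by move/negbFE.
Qed.

(** Otherwise a proper M supplements 'Phi(N) in G; by Dedekind, M :&: N supplements it in N, so N
    lies in M because 'Phi(N) consists of non-generators. *)
Lemma Phi_normalS G N : N <| G -> 'Phi(N) \subset 'Phi(G).
Proof.
move=> nsNG; apply: contraT => nPhi.
have nsPhiG : 'Phi(N) <| G by rewrite gFnormal_trans.
have [M /= defG nPhiM] := normal_not_sub_Phi nsPhiG nPhi.
have defN : 'Phi(N) <*> (M :&: N) = N.
  rewrite norm_joinEr; first by
    rewrite group_modl ?Phi_sub // defG (setIidPr (normal_sub nsNG)).
  by rewrite (subset_trans (subsetIr _ _)) ?normal_norm ?Phi_normal.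
case/negP: nPhiM; rewrite (subset_trans (Phi_sub N)) //.
by rewrite -(Phi_nongen defN) genGid subsetIl.
Qed.

(** Gaschütz's argument: a minimal supplement K of A is a complement. Indeed A :&: K is normal in G,
    being normalised by K and centralised by A; were it nontrivial, a subgroup M supplementing it
    would make M :&: K a smaller supplement of A. *)
Lemma abelian_normal_splits G A :
  'Phi(G) = 1 -> A <| G -> abelian A -> [splits G, over A].
Proof.
move=> Phi1 nsAG abA.
have [K minK _] : {K : {group gT} | [min K | A * K == G] & K \subset G}.
  by apply: mingroup_exists; rewrite mulSGid ?normal_sub.
have [/eqP defG minKP] := mingroupP minK.
have sKG : K \subset G by rewrite -defG mulG_subr.
have nsDG : A :&: K <| G.
  rewrite /normal subIset ?(normal_sub nsAG) //= -defG mulG_subG.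
  rewrite cents_norm ?(centsS (subsetIl _ _)) //=.
  by rewrite normsI ?normG // (subset_trans sKG) ?normal_norm.
apply/splitsP; exists K; apply/complP; split=> //.
apply/trivgP; rewrite -Phi1; apply: contraT => nD.
have [M /= defDM nDM] := normal_not_sub_Phi nsDG nD.
have defK : (A :&: K) * (M :&: K) = K.
  by rewrite group_modl ?subsetIr // defDM (setIidPr sKG).
have defMK : M :&: K = K.
  apply: (minKP (M :&: K)%G); rewrite ?subsetIr //=.
  by rewrite -[X in X * _ == _](mulGSid (subsetIl A K)) -mulgA defK defG.
by case/negP: nDM; rewrite subIset // -defMK subsetIl orbT.
Qed.

(** Each 'O_p(G) has trivial Frattini subgroup, hence is elementary abelian, and cores for distinct
    primes commute. *)
Lemma abelian_Fitting G : 'Phi(G) = 1 -> abelian 'F(G).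
Proof.
move=> Phi1; rewrite FittingEgen abelian_gen.
apply/centsP=> x /bigcupP[p _ Ox] y /bigcupP[q _ Oy].
have abO (r : nat) : abelian 'O_r(G).
  apply: (@abelem_abelian _ r); rewrite -trivg_Phi ?pcore_pgroup //.
  by rewrite -subG1 -Phi1 Phi_normalS ?pcore_normal.
have [eqpq | neqpq] := eqVneq (p : nat) q.
  by move: Oy; rewrite -eqpq => Oy; apply: (centsP (abO p)).
have tiO : 'O_p(G) :&: 'O_q(G) = 1.
  apply: coprime_TIg; apply: (@pnat_coprime p); first exact: pcore_pgroup.
  by apply: pi_pnat (pcore_pgroup q G) _; rewrite !inE eq_sym.
apply: (centsP _ _ Ox _ Oy); apply/commG1P/trivgP; rewrite -tiO.
by rewrite commg_subI // subsetI subxx /=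
  (subset_trans (pcore_sub _ _)) ?gFnorm.
Qed.

Lemma abelian_normal_compl G A T :
    'Phi(G) = 1 -> A <| G -> abelian A -> T <| G -> T \subset A ->
  exists S, [/\ S <| G, T * S = A & T :&: S = 1].
Proof.
move=> Phi1 nsAG abA nsTG sTA.
have /splitsP[K /complP[tiTK defG]] :=
  abelian_normal_splits Phi1 nsTG (abelianS sTA abA).
have sKG : K \subset G by rewrite -defG mulG_subr.
(* K normalises K :&: A and T centralises it, so it is normal in T K = G. *)
exists (K :&: A)%G; split=> /=.
- rewrite /normal subIset ?sKG //= -defG mulG_subG.
  rewrite cents_norm; last by
    rewrite (subset_trans (subset_trans sTA abA)) ?centS ?subsetIr.
  by rewrite normsI ?normG // (subset_trans sKG) ?normal_norm.
- by rewrite group_modl // defG (setIidPr (normal_sub nsAG)).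
by rewrite setIA tiTK; apply/setIidPl; rewrite sub1G.
Qed.

(** A normal M inside the closure D either contains Q, hence D, or centralises D. In the latter case
    M is abelian, so it has a complement K in G and D = M (K :&: D); perfectness of D gives D <= K,
    so M = 1. *)
Lemma component_closure_minnormal G Q :
  'Phi(G) = 1 -> component G Q -> minnormal <<class_support Q G>> G.
Proof.
move=> Phi1 cQ; have /andP[snQ /quasisimpleP[pQ ntQ _]] := cQ.
pose D := <<class_support Q G>>%G.
have sQD : Q \subset D by rewrite sub_gen ?sub_class_support.
have minD (N : {group gT}) : Q \subset N -> G \subset 'N(N) -> D \subset N.
  by move=> sQN nNG; rewrite gen_subG class_support_sub_norm.
have nDG : G \subset 'N(D) by rewrite norms_gen ?class_support_norm.
have sDG : D \subset G by rewrite minD ?normG ?subnormal_sub.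
apply/(@mingroupP _ _ D); split.
  by rewrite nDG andbT; apply: contraNneq ntQ => D1; rewrite -subG1 -D1.
move=> M /andP[ntM nMG] sMD; apply/eqP; rewrite eqEsubset sMD /=.
have nsMG : M <| G by rewrite /normal nMG (subset_trans sMD).
have [sQM | cMQ] := component_sub_or_cent cQ nsMG; first exact: minD.
have cMD : D \subset 'C(M) by rewrite minD ?norms_cent.
have /splitsP[K /complP[tiMK defG]] :=
  abelian_normal_splits Phi1 nsMG (subset_trans sMD cMD).
have sDD : D \subset D^`(1).
  by rewrite minD ?gFnorm_trans // -{1}pQ commgSS.
have defD : M * (K :&: D) = D by rewrite group_modl // defG (setIidPr sDG).
have nKD : D \subset 'N(K :&: D).
  rewrite -{1}defD mulG_subG normG andbT.
  by rewrite cents_norm // centsC (subset_trans (subsetIr _ _)).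
have sDK : D \subset K :&: D.
  apply: subset_trans sDD _; apply: der1_min => //.
  rewrite -{1}defD quotientMidr quotient_abelian //.
  exact: subset_trans sMD cMD.
case/negP: ntM; rewrite -subG1 -tiMK subsetI subxx.
by rewrite (subset_trans sMD) // (subset_trans sDK) ?subsetIl.
Qed.

(** This expresses that minimal normal subgroups generate [gen_Fitting G]: M is found in a normal
    complement of 'F(G) :&: H in 'F(G), or as the closure of a component outside H. *)
Lemma minnormal_gen_Fitting_avoid G H :
    'Phi(G) = 1 -> H <| G -> ~~ (gen_Fitting G \subset H) ->
  exists M, [/\ minnormal M G, M \subset gen_Fitting G & ~~ (M \subset H)].
Proof.
move=> Phi1 nsHG nRH.
have sFR : 'F(G) \subset gen_Fitting G by exact: mulG_subr.
have [sFH | nFH] := boolP ('F(G) \subset H); last first.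
  have abF := abelian_Fitting Phi1; have nsFG := Fitting_normal G.
  have [|S [nsSG defF tiS]] := abelian_normal_compl Phi1 nsFG abF (normalI nsFG nsHG).
    exact: subsetIl.
  have sSF : S \subset 'F(G) by rewrite -defF mulG_subr.
  have ntS : S :!=: 1.
    apply: contraNneq nFH => S1.
    by rewrite -defF S1 mulg1 subsetIr.
  have [M minM sMS] := minnormal_exists ntS (normal_norm nsSG).
  exists M; split=> //; first exact: subset_trans (subset_trans sMS sSF) sFR.
  have [/andP[ntM _] _] := mingroupP minM.
  apply: contra ntM => sMH; rewrite -subG1 -tiS !subsetI sMH sMS.
  by rewrite (subset_trans sMS sSF).
have /existsP[Q /andP[cQ nQH]] :
    [exists Q : {group gT}, component G Q && ~~ (Q \subset H)].
  apply: contraR nRH => /existsPn noQ; rewrite mul_subG //.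
  rewrite /layer bigprodGE gen_subG; apply/bigcupsP=> Q cQ.
  by have := noQ Q; rewrite cQ negbK.
exists <<class_support Q G>>%G; split=> /=.
- exact: component_closure_minnormal.
- rewrite gen_subG class_support_sub_norm ?component_sub_gen_Fitting //.
  by rewrite normal_norm ?gen_Fitting_normal.
apply: contra nQH; apply: subset_trans.
by rewrite sub_gen ?sub_class_support.
Qed.

Lemma gen_Fitting_compl G T :
    'Phi(G) = 1 -> T <| G -> T \subset gen_Fitting G ->
  exists S, [/\ S <| G, T * S = gen_Fitting G & T :&: S = 1].
Proof.
move=> Phi1 nsTG sTR; pose R := gen_Fitting_group G.
pose P S := [&& S <| G, S \subset R & T :&: S == 1].
(* If T S missed part of R, a minimal normal M outside T S would meet it trivially, and S M would
   contradict the maximality of S. *)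
have [S maxS _] : {S : {group gT} | maxgroup S P & 1%G \subset S}.
  by apply: maxgroup_exists; rewrite /P normal1 sub1G (setIidPr (sub1G T)) eqxx.
have [/and3P[nsSG sSR /eqP tiTS] maxSP] := maxgroupP maxS.
exists S; split=> //; apply/eqP; rewrite eqEsubset mul_subG //=.
have defTS : T * S = T <*> S.
  by rewrite norm_joinEr // (subset_trans (normal_sub nsSG)) ?normal_norm.
rewrite defTS; apply: contraT => nRTS.
have [M [minM sMR nMTS]] := minnormal_gen_Fitting_avoid Phi1 (normalY nsTG nsSG) nRTS.
have [/andP[ntM nMG] minMP] := mingroupP minM.
have nsMG : M <| G.
  by rewrite /normal nMG (subset_trans sMR) ?normal_sub ?gen_Fitting_normal.
have tiM : M :&: (T <*> S) = 1.
  apply/eqP; apply: contraR nMTS => ntI.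
  rewrite -(minMP (M :&: (T <*> S))%G) ?subsetIl ?subsetIr //= ntI.
  by rewrite normsI ?normal_norm ?normalY.
have defSM : S * M = S <*> M.
  by rewrite norm_joinEr // (subset_trans (normal_sub nsMG)) ?normal_norm.
have PSM : P (S <*> M)%G.
  rewrite /P normalY // join_subG sSR sMR /= -subG1 /= -defSM.
  apply/subsetP=> x /setIP[Tx /mulsgP[s m Ss Mm def_x]].
  have: m \in M :&: (T <*> S).
    rewrite inE Mm -[m](mulKg s) -def_x groupM //.
      by rewrite groupV; apply: (subsetP (joing_subr T S)).
    exact: (subsetP (joing_subl T S)).
  rewrite tiM => /set1P m1; rewrite m1 mulg1 in def_x.
  by rewrite def_x -tiTS inE Ss -def_x Tx.
case/negP: nMTS; apply: subset_trans (joing_subr T S).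
by rewrite -(maxSP _ PSM) ?joing_subl ?joing_subr.
Qed.

(** * Nontriviality of the generalised Fitting subgroup *)

Lemma simple_nonabelian_quasisimple Q :
  simple Q -> ~~ abelian Q -> quasisimple Q.
Proof.
case/simpleP=> ntQ simQ nabQ; apply/quasisimpleP; split=> // [|T /simQ[-> | ->]].
- have [Q1 | //] := simQ _ (der_normal 1 Q).
  by case/negP: nabQ; apply/commG1P.
- by left; rewrite sub1G.
by right.
Qed.

Lemma subnormal_nil_sub_Fitting G Q :
  Q <|<| G -> nilpotent Q -> Q \subset 'F(G).
Proof.
move=> snQ nilQ; have [n] := ubnP #|G|.
elim: n => // n IHn in G snQ *; rewrite ltnS => leGn.
have [defG | [K [snQK nsKG prKG]]] := subnormalEr snQ.
  by rewrite -defG Fitting_max.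
apply: subset_trans (IHn K snQK _) _; first exact: leq_trans (proper_card prKG) _.
by rewrite Fitting_max ?Fitting_nil ?gFnormal_trans.
Qed.

(** A minimal nontrivial subnormal subgroup lies in 'F(G) if abelian; otherwise it is simple, hence
    a component. *)
Lemma gen_Fitting_neq1 G : G :!=: 1 -> gen_Fitting G != 1.
Proof.
move=> ntG; pose P Q := (Q :!=: 1) && (Q <|<| G).
have [Q minQ _] : {Q : {group gT} | mingroup Q P & Q \subset G}.
  by apply: mingroup_exists; rewrite /P ntG subnormal_refl.
have [/andP[ntQ snQ] minQP] := mingroupP minQ.
apply: contraNneq (ntQ) => R1; rewrite -subG1 -R1.
have [abQ | nabQ] := boolP (abelian Q).
  apply: subset_trans (subnormal_nil_sub_Fitting snQ (abelian_nil abQ)) _.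
  exact: mulG_subr.
rewrite component_sub_gen_Fitting // /component snQ.
apply: simple_nonabelian_quasisimple => //; apply/simpleP; split=> // T nsTQ.
have [T1 | ntT] := eqVneq T 1%G; [by left; rewrite T1 | right].
apply: minQP; last exact: normal_sub.
by rewrite /P ntT (subnormal_trans (normal_subnormal nsTQ)).
Qed.

End FrattiniFree.

(** * Gluing complements along the series *)

Section Splitting.

Variable gT : finGroupType.
Implicit Types F G H K L N P R S : {group gT}.

(* If L0, H and P are complements of NR, R and F, then P :&: S(H :&: R L0) is a *)
(* complement of N.                                                             *)
Lemma splits_relative_factor G F N R S :
    N <| G -> R <| G -> S <| G -> F \subset N ->
    (N :&: R) * S = R -> (N :&: R) :&: S = F ->
    [splits G, over F] -> [splits G, over R] -> [splits G, over N * R] ->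
  [splits G, over N].
Proof.
move=> nsNG nsRG nsSG sFN defR defF.
case/splitsP=> P /complP[tiFP defFP] /splitsP[H /complP[tiRH defRH]].
case/splitsP=> L0 /complP[tiNRL defNRL].
have defNR : N * R = N <*> R.
  by rewrite norm_joinEr // (subset_trans (normal_sub nsRG)) ?normal_norm.
have sL0G : L0 \subset G by rewrite -defNRL defNR mulG_subr.
have sHG : H \subset G by rewrite -defRH mulG_subr.
have sSR : S \subset R by rewrite -defR mulG_subr.
have sFS : F \subset S by rewrite -defF subsetIr.
have defL : R * L0 = R <*> L0.
  by rewrite norm_joinEr // (subset_trans sL0G) ?normal_norm.
set L := (R <*> L0)%G in defL.
have sLG : L \subset G by rewrite join_subG normal_sub.
have tiNRL0 : (N * R) :&: L = R.
  rewrite -[X in _ :&: X]defL setIC defNR -group_modl ?joing_subr //=.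
  by rewrite setIC -defNR tiNRL mulg1.
have defRHL : R * (H :&: L) = L.
  by rewrite group_modl ?joing_subl // defRH (setIidPr sLG).
have defK : S * (H :&: L) = S <*> (H :&: L).
  rewrite norm_joinEr // (subset_trans (subsetIl H L)) //.
  by rewrite (subset_trans sHG) ?normal_norm.
set K := (S <*> (H :&: L))%G in defK.
have sFK : F \subset K by rewrite (subset_trans sFS) ?joing_subl.
apply/splitsP; exists (P :&: K)%G; apply/complP; split=> /=; last first.
  have sKG : K \subset G by rewrite join_subG normal_sub // subIset ?sHG.
  (* N (P :&: K) = N F (P :&: K) = N K, and N K = N (N :&: R) S (H :&: L) = N R (H :&: L) = N L =
     G. *)
  rewrite -[X in X * _](mulGSid sFN) -mulgA group_modl // defFP (setIidPr sKG).
  rewrite -[K : {set gT}]defK -[X in X * _](mulGSid (subsetIl N R)).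
  rewrite mulgA -(mulgA N) defR.
  by rewrite -mulgA defRHL -[L : {set gT}]defL mulgA defNRL.
(* It remains to see that N :&: K lies in F. An element x = s h of it lies in N R :&: L = R, so h is
   in R :&: H = 1 and x = s is in (N :&: R) :&: S = F. *)
apply/trivgP; rewrite -tiFP /= setICA setIC setSI //.
apply/subsetP=> x /setIP[Nx]; rewrite -[K : {set gT}]defK.
case/mulsgP=> s h Ss /setIP[Hh Lh] def_x.
have Rs := subsetP sSR s Ss.
have Rx : x \in R.
  rewrite -tiNRL0 inE (subsetP (mulG_subl R N)) //= def_x groupM //.
  by rewrite (subsetP (joing_subl R L0)).
have : h \in R :&: H by rewrite inE Hh -(groupMl _ Rs) -def_x Rx.
rewrite tiRH => /set1P h1; rewrite h1 mulg1 in def_x.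
by rewrite -defF !inE Nx Rx def_x.
Qed.

Lemma splits_gen_Fitting_quotient G F R N :
    R :=: coset F @*^-1 gen_Fitting (G / F) -> 'Phi(G / F) = 1 ->
    F <| G -> N <| G -> F \subset N ->
    [splits G, over F] -> [splits G, over R] -> [splits G, over N * R] ->
  [splits G, over N].
Proof.
move=> defRF Phi1 nsFG nsNG sFN spF.
have nsRG : R <| G.
  by rewrite defRF -[X in _ <| X](quotientGK nsFG) cosetpre_normal gen_Fitting_normal.
have sFR : F \subset R by rewrite defRF normal_sub ?normal_cosetpre.
have nsNRF : (N :&: R) / F <| G / F.
  exact: quotient_normal (normalI nsNG nsRG).
have nsFNR : F <| N :&: R.
  apply: normalS nsFG; first by rewrite subsetI sFN.
  exact: subset_trans (subsetIl N R) (normal_sub nsNG).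
have defNR : coset F @*^-1 ((N :&: R) / F) = N :&: R by rewrite quotientGK.
(* The preimage in G of this S serves as the S of [splits_relative_factor]. *)
have [|S [nsSG defR tiS]] := gen_Fitting_compl Phi1 nsNRF.
  by rewrite -cosetpreSK -defRF defNR subsetIr.
have nsSG' : coset F @*^-1 S <| G.
  by rewrite -[X in _ <| X](quotientGK nsFG) cosetpre_normal.
apply: (splits_relative_factor nsNG nsRG nsSG' sFN _ _ spF).
  by rewrite -[X in X * _]defNR -cosetpreM defR.
by rewrite -[X in X :&: _]defNR -morphpreI tiS cosetpre1.
Qed.

Lemma gen_Fitting_atS G i :
  gen_Fitting_at i.+1 G =
    coset (gen_Fitting_at i G) @*^-1 gen_Fitting (G / gen_Fitting_at i G).
Proof. by []. Qed.

(** The iterate is a bare set; exhibiting an equal group F lets the group lemmas apply to it. *)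
Lemma gen_Fitting_at_normal G i :
  exists2 F : {group gT}, gen_Fitting_at i G = F & F <| G.
Proof.
elim: i => [|i [F defF nsFG]]; first by exists 1%G; rewrite ?normal1.
exists [group of coset F @*^-1 gen_Fitting (G / F)].
  by rewrite gen_Fitting_atS defF.
by rewrite -[X in _ <| X](quotientGK nsFG) cosetpre_normal gen_Fitting_normal.
Qed.

Lemma nCgroup_of_splits G :
    Bgroup G -> (forall i, [splits G, over gen_Fitting_at i G]) -> nCgroup G.
Proof.
move=> BG spG.
suffices spN i N : N <| G -> gen_Fitting_at i G \subset N -> [splits G, over N].
  by move=> N nsNG; apply: (spN 0 N nsNG); exact: sub1G.
have [F defF nsFG] := gen_Fitting_at_normal G i.
(* The index of F_i decreases as i grows, so this is a downward induction on i that needs no a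
   priori length of the series. *)
have [n] := ubnP #|G : F|; elim: n => // n IHn in i F defF nsFG N *.
rewrite ltnS => leGFn nsNG; rewrite defF => sFN.
have [defG | neFG] := eqVneq (F : {set gT}) G.
  have ->: N :=: G by apply/eqP; rewrite eqEsubset normal_sub // -defG.
  apply/splitsP; exists 1%G; apply/complP.
  by rewrite mulg1; split=> //; apply/setIidPr; rewrite sub1G.
have [R defR nsRG] := gen_Fitting_at_normal G i.+1.
have defRF : R :=: coset F @*^-1 gen_Fitting (G / F).
  by rewrite -defR gen_Fitting_atS defF.
have sRG := normal_sub nsRG.
have ltRF : F \proper R.
  rewrite properEneq defRF normal_sub ?normal_cosetpre // andbT.
  have ntGF : G / F != 1.
    rewrite -subG1 quotient_sub1 ?normal_norm //.
    by apply: contra neFG => sGF; rewrite eqEsubset normal_sub.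
  apply: contraNneq (gen_Fitting_neq1 ntGF) => defF1.
  by rewrite -[gen_Fitting _]cosetpreK -defF1 trivg_quotient.
have defNR : N * R = N <*> R.
  by rewrite norm_joinEr // (subset_trans sRG) ?normal_norm.
apply: (splits_gen_Fitting_quotient defRF (BG F nsFG) nsFG nsNG sFN).
- by rewrite -defF.
- by rewrite -defR.
rewrite defNR; apply: (IHn i.+1 R) => //; rewrite ?normalY //.
  apply: leq_trans leGFn; rewrite -(Lagrange_index sRG (proper_sub ltRF)).
  rewrite -[X in X < _]muln1 ltn_pmul2l //.
  by rewrite indexg_gt1 proper_subn.
by rewrite defR joing_subr.
Qed.

End Splitting.

Theorem theorem1p3 (gT : finGroupType) (G : {group gT}) :
  Bgroup G ->
  (nCgroup G <-> forall i : nat, [splits G, over gen_Fitting_at i G]).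
Proof.
move=> BG; split; last exact: nCgroup_of_splits.
move=> nCG i; have [F -> nsFG] := gen_Fitting_at_normal G i.
exact: nCG.
Qed.
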